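(* Let $K\hookrightarrow L$ be a graph pair where $L$ is connected. Let $\tilde K=(V^K,E^{\tilde K},w^{\tilde K})$ denote the weighted graph with vertex set $V^K$ such that its graph Laplacian satisfies $\boldsymbol{\Delta}_0^{\tilde K}=\boldsymbol{\Delta}_0^{K,L}$. Then $\tilde K$ is connected, and for any two distinct vertices $v,w\in V^K$ we have $$\mathfrak{R}_{v,w}^L=\mathfrak{R}_{v,w}^{\tilde K}.$$
   Context: A weighted graph $G=(V^G,E^G,w^G)$ is a finite simple graph, viewed as a simplicial complex of dimension at most $1$ on a finite totally ordered vertex set, with positive edge weights $w^G(e)$, $e\in E^G$; all vertices have weight $1$. The Laplacian matrix $\boldsymbol{\Delta}_0^G$ has diagonal entries $\sum_{w:\{v,w\}\in E^G}w^G(\{v,w\})$, entries $-w^G(\{v,w\})$ for edges $\{v,w\}$, and $0$ otherwise. A graph pair $K\hookrightarrow L$ consists of weighted graphs with $V^K\subseteq V^L$, $E^K\subseteq E^L$ and $w^K=w^L|_K$ (with $V^K\neq\emptyset$). Persistent Laplacian: $C_0^G$ is the real vector space with orthonormal basis the vertices of $G$; $C_1^G$ has basis the oriented edges $[v,w]$ ($v<w$), orthogonal with $\langle[v,w],[v,w]\rangle=w^G(\{v,w\})^{-1}$; $\partial_1^G[v,w]=[w]-[v]$. Let $C_1^{L,K}=\{c\in C_1^L:\partial_1^Lc\in C_0^K\}$ with the inner product restricted from $C_1^L$ and $\partial_1^{L,K}:C_1^{L,K}\to C_0^K$ the restriction of $\partial_1^L$. Then $\Delta_0^{K,L}=\partial_1^{L,K}(\partial_1^{L,K})^*$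 on $C_0^K$, and $\boldsymbol{\Delta}_0^{K,L}$ is its matrix in the vertex basis. It is a known fact that, when $L$ is connected, $\boldsymbol{\Delta}_0^{K,L}$ is the Laplacian matrix of a weighted graph $\tilde K$ on $V^K$ (the Kron reduction of $L$). For a connected weighted graph $G$ and vertices $v,w$, the effective resistance is $\mathfrak{R}_{v,w}^G=(\chi_w-\chi_v)^{\mathrm T}(\boldsymbol{\Delta}_0^G)^\dagger(\chi_w-\chi_v)$, where $\chi_v$ is the indicator vector of $v$ and $\dagger$ the Moore–Penrose inverse. *)

(* Defs.v *)
From HB Require Import structures.
From mathcomp Require Import all_boot all_order all_algebra.
From mathcomp Require Import boolp classical_sets reals.

Set Implicit Arguments.
Unset Strict Implicit.
Unset Printing Implicit Defensive.

Import Order.TTheory GRing.Theory Num.Theory.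
Local Open Scope ring_scope.

(* The vertex set is a parameter of the type, so that graphs on the same      *)
(* vertex set have Laplacian matrices of the same type. An edge {v, w} is the *)
(* two-element set [set v; w]; the values of wt outside eset are irrelevant.  *)
Record wgraph (R : realType) (d : Order.disp_t) (T : finOrderType d)
    (V : {set T}) := WGraph {
  eset : {set {set T}};
  wt : {set T} -> R;
  eset_sub : forall e, e \in eset -> e \subset V /\ #|e| = 2;
  wt_gt0 : forall e, e \in eset -> 0 < wt e }.

Section Graphs.
Variables (R : realType) (d : Order.disp_t) (T : finOrderType d).
Implicit Types V VK VL : {set T}.

Definition adj V (G : wgraph R V) : rel T := fun v w => [set v; w] \in eset G.

Definition connected_graph V (G : wgraph R V) : Prop :=
  {in V &, forall v w, connect (adj G) v w}.

Definition graph_pair VK VL (K : wgraph R VK) (L : wgraph R VL) : Prop :=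
  [/\ VK != finset.set0, VK \subset VL, eset K \subset eset L
    & {in eset K, wt K =1 wt L}].

(* Rows and columns are indexed by the vertices through enum_val. *)
Definition laplacian V (G : wgraph R V) : 'M[R]_#|V| :=
  \matrix_(i, j)
    let v := enum_val i in let w := enum_val j in
    if v == w then \sum_(u in V | adj G v u) wt G [set v; u]
    else if adj G v w then - wt G [set v; w] else 0.

End Graphs.

Section LinearAlgebra.
Variable R : realType.

Definition is_adjoint (U W : vectType R) (ipU : U -> U -> R) (ipW : W -> W -> R)
    (f : 'Hom(U, W)) (g : 'Hom(W, U)) : Prop :=
  forall u w, ipW (f u) w = ipU u (g w).

Definition adjoint (U W : vectType R) (ipU : U -> U -> R) (ipW : W -> W -> R)
    (f : 'Hom(U, W)) : 'Hom(W, U) :=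
  xget 0 (is_adjoint ipU ipW f).

Lemma adjointP (U W : vectType R) (ipU : U -> U -> R) (ipW : W -> W -> R)
    (f : 'Hom(U, W)) :
  (forall v, linear (ipU v : U -> R^o)) ->
  (forall v, linear (ipU^~ v : U -> R^o)) ->
  (forall v, ipU v v = 0 -> v = 0) ->
  (forall w, linear (ipW w : W -> R^o)) ->
  (forall w, linear (ipW^~ w : W -> R^o)) ->
  is_adjoint ipU ipW f (adjoint ipU ipW f).
Proof.
move=> linUr linUl defU linWr linWl.
suff: exists g, is_adjoint ipU ipW f g by move=> /(xgetPex 0).
pose n := \dim {:U}; pose b (i : 'I_n) := (vbasis {:U})`_i.
have bE u : u = \sum_i coord (vbasis {:U}) i u *: b i.
  exact: coord_vbasis (memvf u).
have sumL (X : vectType R) (h : X -> R^o) (c : 'I_n -> R) x : linear h ->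
    h (\sum_i c i *: x i) = \sum_i c i * h (x i).
  move=> hl; pose hL := GRing.isLinear.Build R X R^o *:%R h hl.
  pose H : {linear X -> R^o} := HB.pack h hL.
  rewrite -[h]/(H : X -> R^o) linear_sum; apply: eq_bigr => i _.
  by rewrite linearZ.
pose phi0 (v : U) : 'rV[R]_n := \row_i ipU (b i) v.
pose psi0 (w : W) : 'rV[R]_n := \row_i ipW (f (b i)) w.
have phil : linear phi0.
  by move=> a u v; apply/rowP => i; rewrite !mxE linUr.
have psil : linear psi0.
  by move=> a u v; apply/rowP => i; rewrite !mxE linWr.
pose phiL := GRing.isLinear.Build R U 'rV[R]_n *:%R phi0 phil.
pose psiL := GRing.isLinear.Build R W 'rV[R]_n *:%R psi0 psil.
pose phiM : {linear U -> 'rV[R]_n} := HB.pack phi0 phiL.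
pose psiM : {linear W -> 'rV[R]_n} := HB.pack psi0 psiL.
pose phi := linfun phiM; pose psi := linfun psiM.
have ker0 : lker phi == 0%VS.
  rewrite -subv0; apply/subvP => v; rewrite memv_ker memv0 lfunE /= => /eqP v0.
  apply/eqP/defU; rewrite [X in ipU X _]bE (sumL _ (ipU^~ v)) //.
  apply: big1 => i _; have /rowP/(_ i) := v0; rewrite !mxE => ->.
  by rewrite mulr0.
have img : limg phi = fullv.
  apply/eqP; rewrite eqEdim subvf /=.
  have := limg_ker_dim phi fullv; rewrite (eqP ker0) capv0 dimv0 add0n => ->.
  by rewrite dimvf /dim /= mul1n.
exists (phi^-1 \o psi)%VF => u w.
have /rowP E : phi0 ((phi^-1 \o psi)%VF w) = psi0 w.
  rewrite comp_lfunE -[LHS](lfunE phiM) limg_lfunVK ?lfunE //.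
  by rewrite img memvf.
rewrite [u]bE linear_sum /=.
rewrite (sumL _ (ipU^~ _)) //.
transitivity (\sum_i coord (vbasis {:U}) i u * ipW (f (b i)) w).
  rewrite -(sumL _ (ipW^~ w)) //; congr (ipW _ _).
  by apply: eq_bigr => i _; rewrite linearZ.
by apply: eq_bigr => i _; have := E i; rewrite !mxE => <-.
Qed.

Definition is_MPinverse m n (A : 'M[R]_(m, n)) (X : 'M[R]_(n, m)) : Prop :=
  [/\ A *m X *m A = A, X *m A *m X = X,
      (A *m X)^T = A *m X & (X *m A)^T = X *m A].

Definition MPinverse m n (A : 'M[R]_(m, n)) : 'M[R]_(n, m) :=
  xget 0 (is_MPinverse A).

Lemma gram_unit r k (F : 'M[R]_(r, k)) : row_free F -> F *m F^T \in unitmx.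
Proof.
move=> Ffree; rewrite -row_free_unit -kermx_eq0; apply/eqP/row_matrixP => i.
rewrite row0; set x := row i _.
have x0 : x *m (F *m F^T) = 0.
  by rewrite -row_mul mulmx_ker row0.
have : x *m F *m (x *m F)^T = 0 by rewrite trmx_mul mulmxA -(mulmxA x) x0 mul0mx.
move=> /matrixP/(_ 0 0); rewrite mxE [RHS]mxE => /eqP.
under eq_bigr do rewrite [_^T _ _]mxE -expr2.
rewrite psumr_eq0 => [|j _]; last exact: sqr_ge0.
move=> /allP xF0; apply: (row_free_inj Ffree); rewrite mul0mx.
apply/rowP => j; have := xF0 j (mem_index_enum _).
by rewrite sqrf_eq0 => /eqP ->; rewrite mxE.
Qed.

Lemma MPinverseP m n (A : 'M[R]_(m, n)) : is_MPinverse A (MPinverse A).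
Proof.
suff: exists X, is_MPinverse A X by move=> /(xgetPex 0).
have [r [C [F [uC uF ->]]]] : exists r (C : 'M_(m, r)) (F : 'M_(r, n)),
    [/\ C^T *m C \in unitmx, F *m F^T \in unitmx & A = C *m F].
  exists (\rank A), (col_base A), (row_base A); split.
  - rewrite -[X in _ *m X]trmxK; apply: gram_unit.
    by rewrite /row_free mxrank_tr; apply: col_base_full.
  - exact/gram_unit/row_base_free.
  - by rewrite mulmx_base.
pose X := F^T *m invmx (F *m F^T) *m (invmx (C^T *m C) *m C^T).
have AXE : C *m F *m X = C *m invmx (C^T *m C) *m C^T.
  by rewrite /X !mulmxA -(mulmxA C F) mulmxK.
have XAE : X *m (C *m F) = F^T *m invmx (F *m F^T) *m F.
  by rewrite /X -!mulmxA (mulmxA C^T) mulKmx.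
exists X; split.
- by rewrite AXE -!mulmxA (mulmxA C^T) mulKmx.
- by rewrite XAE /X !mulmxA -(mulmxA _ F) mulmxKV.
- by rewrite AXE !trmx_mul trmx_inv trmx_mul !trmxK mulmxA.
- by rewrite XAE !trmx_mul trmx_inv trmx_mul !trmxK mulmxA.
Qed.

End LinearAlgebra.

Section Chains.
Variables (R : realType) (d : Order.disp_t) (T : finOrderType d).
Implicit Types V VK VL : {set T}.

(* C_0^G and C_1^G are realized inside the spaces with bases T and T * T, so  *)
(* that V^K \subset V^L makes C_0^K literally a subspace of C_0^L.            *)
Definition vchain (v : T) : {ffun T -> R^o} := [ffun u => (u == v)%:R].
Definition echain (e : T * T) : {ffun T * T -> R^o} := [ffun p => (p == e)%:R].

Definition oriented_edges V (G : wgraph R V) : {set T * T} :=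
  [set e | (e.1 < e.2)%O & [set e.1; e.2] \in eset G].

Definition C0 V : {vspace {ffun T -> R^o}} :=
  <<[seq vchain v | v <- enum V]>>%VS.
Definition C1 V (G : wgraph R V) : {vspace {ffun T * T -> R^o}} :=
  <<[seq echain e | e <- enum (oriented_edges G)]>>%VS.

Definition ip0 (x y : {ffun T -> R^o}) : R := \sum_v x v * y v.
Definition ip1 V (G : wgraph R V) (c c' : {ffun T * T -> R^o}) : R :=
  \sum_(e in oriented_edges G) (wt G [set e.1; e.2])^-1 * (c e * c' e).

Definition boundary_fun (c : {ffun T * T -> R^o}) : {ffun T -> R^o} :=
  \sum_e c e *: (vchain e.2 - vchain e.1).

Lemma boundary_fun_is_linear : linear boundary_fun.
Proof.
move=> a c c'; rewrite /boundary_fun scaler_sumr -big_split /=.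
by apply: eq_bigr => e _; rewrite !ffunE scalerDl scalerA.
Qed.

HB.instance Definition _ := GRing.isLinear.Build R {ffun T * T -> R^o}
  {ffun T -> R^o} _ boundary_fun boundary_fun_is_linear.

Definition boundary : 'Hom({ffun T * T -> R^o}, {ffun T -> R^o}) :=
  linfun boundary_fun.

Lemma boundary_echain e : boundary (echain e) = vchain e.2 - vchain e.1.
Proof.
rewrite lfunE /= /boundary_fun (bigD1 e) //= ffunE eqxx scale1r.
by rewrite big1 ?addr0 // => p /negPf pe; rewrite ffunE pe scale0r.
Qed.

Definition C1_pers VK VL (L : wgraph R VL) : {vspace {ffun T * T -> R^o}} :=
  (C1 L :&: boundary @^-1: C0 VK)%VS.

Definition boundary_pers VK VL (L : wgraph R VL) :
    'Hom(subvs_of (C1_pers VK L), subvs_of (C0 VK)) :=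
  (linfun (vsproj (C0 VK)) \o boundary \o linfun (@vsval _ _ (C1_pers VK L)))%VF.

Definition ip_C0 V (x y : subvs_of (C0 V)) : R := ip0 (vsval x) (vsval y).
Definition ip_C1_pers VK VL (L : wgraph R VL)
    (c c' : subvs_of (C1_pers VK L)) : R := ip1 L (vsval c) (vsval c').

Lemma boundary_pers_adjointP VK VL (L : wgraph R VL) :
  is_adjoint (@ip_C1_pers VK VL L) (@ip_C0 VK) (boundary_pers VK L)
    (adjoint (@ip_C1_pers VK VL L) (@ip_C0 VK) (boundary_pers VK L)).
Proof.
have ffunZD (I : finType) (a : R) (x y : {ffun I -> R^o}) i :
  (a *: x + y) i = a * x i + y i by rewrite !ffunE.
apply: adjointP => [c a x y|c a x y|c|z a x y|z a x y];
  rewrite /ip_C1_pers /ip_C0 /ip1 /ip0 ?linearP /=.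
- rewrite scaler_sumr -big_split; apply: eq_bigr => e _ /=.
  by rewrite ffunZD mulrDr mulrDr /GRing.scale /= !(mulrCA _ a).
- rewrite scaler_sumr -big_split; apply: eq_bigr => e _ /=.
  by rewrite ffunZD mulrDl mulrDr /GRing.scale /= -mulrA (mulrCA _ a).
- have wgt e : e \in oriented_edges L -> 0 < (wt L [set e.1; e.2]%SET)^-1.
    by rewrite finset.inE => /andP[_ eL]; rewrite invr_gt0 wt_gt0.
  move=> /eqP; rewrite psumr_eq0 => [/allP c0|e eL]; last first.
    by rewrite -expr2 mulr_ge0 ?sqr_ge0 // ltW ?wgt.
  apply/val_inj/ffunP => e; rewrite [RHS]ffunE /=.
  have [eL|eL] := boolP (e \in oriented_edges L).
    have := c0 e (mem_index_enum _); rewrite eL /= mulf_eq0 gt_eqF ?wgt //=.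
    by rewrite -expr2 sqrf_eq0 => /eqP.
  have := subvsP c; rewrite memv_cap => /andP[/coord_span -> _].
  rewrite sum_ffunE big1 // => i _; rewrite ffunE.
  set s := map_tuple _ _; have : s`_i \in s by rewrite mem_nth ?size_tuple.
  case/mapP => p; rewrite mem_enum => pL ->; rewrite ffunE.
  by case: eqP => [ep|_]; [rewrite ep pL in eL|rewrite scaler0].
- rewrite scaler_sumr -big_split; apply: eq_bigr => e _ /=.
  by rewrite ffunZD mulrDr /GRing.scale /= (mulrCA _ a).
- rewrite scaler_sumr -big_split; apply: eq_bigr => e _ /=.
  by rewrite ffunZD mulrDl /GRing.scale /= -mulrA.
Qed.

Definition pers_laplacian_map VK VL (L : wgraph R VL) :
    'End(subvs_of (C0 VK)) :=
  (boundary_pers VK L \o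
     adjoint (@ip_C1_pers VK VL L) (@ip_C0 VK) (boundary_pers VK L))%VF.

(* Only the vertex set of K enters. Column j holds the coordinates of the     *)
(* image of the j-th vertex of K.                                             *)
Definition pers_laplacian VK VL (K : wgraph R VK) (L : wgraph R VL) :
    'M[R]_#|VK| :=
  \matrix_(i, j)
    vsval (pers_laplacian_map VK L (vsproj (C0 VK) (vchain (enum_val j))))
      (enum_val i).

Definition indicator V (v : T) : 'cV[R]_#|V| :=
  \col_i (enum_val i == v)%:R.

Definition eff_res V (G : wgraph R V) (v w : T) : R :=
  ((indicator V w - indicator V v)^T *m MPinverse (laplacian G)
     *m (indicator V w - indicator V v)) 0 0.

End Chains.

(* Main.v *)
Require Import Defs.
From mathcomp Require Import reals.
From mathcomp Require Import all_boot all_order all_algebra.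

(** The effective resistance between [v] and [w] is a potential difference: it
    equals [f w - f v] for any function [f] on the vertices whose Laplacian is
    [chi_w - chi_v] ([eff_res_potential]). Call the search for such an [f] the
    unit flow problem; it is solvable on a connected graph ([potential_exists]).

    The persistent Laplacian sees the same potentials. Let [f] be a function on
    the vertices of [L] whose Laplacian [p] vanishes off [VK]. The Ohm current
    of [f], which sends the edge [[a, b]] to [wt [a, b] * (f b - f a)], has
    boundary [p], so it belongs to the space of chains with boundary in [C0 VK].
    Summation by parts says that its inner product with any chain [c] of that
    space is the pairing of [f] with the boundary of [c]. As this boundary is
    supported on [VK], only the restriction of [f] to [VK] matters, and the
    current is thus the image of that restriction under the adjoint of the
    boundary map. Taking the boundary once more, the persistent Laplacian sends
    the restriction of [f] to [p] ([pers_laplacian_potential]).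

    Hence one [f] solves the unit flow problem between [v] and [w], two vertices
    of [VK], on [L] and, once restricted, on [Ktilde]. Both resistances are
    [f w - f v]. Moreover [Ktilde] is connected, because the unit flow problem
    cannot be solved between two components: the indicator function of a
    component is harmonic, and the Laplacian is symmetric, so every function in
    its range sums to zero over each component ([connected_of_potentials]). *)

Section EffectiveResistance.
Set Implicit Arguments.
Unset Strict Implicit.
Unset Printing Implicit Defensive.
Import Order.TTheory GRing.Theory Num.Theory.
Local Open Scope ring_scope.

(** * Linear algebra *)

(** A symmetric [A] turns the quadratic form of its pseudo-inverse into an
    ordinary pairing with any preimage: [x^T A A^+ A x = x^T A x]. *)
Lemma quad_MPinverse (R : realType) n (A : 'M[R]_n) (x b : 'cV[R]_n) :
  A^T = A -> A *m x = b -> b^T *m MPinverse A *m b = b^T *m x.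
Proof.
move=> symA <-; have [AXA _ _ _] := MPinverseP A.
by rewrite trmx_mul symA !mulmxA -!(mulmxA x^T) AXA.
Qed.

Lemma mem_span_delta (R : realType) (I : finType) (A : {set I})
    (x : {ffun I -> R^o}) :
  (x \in <<[seq ([ffun u => (u == v)%:R] : {ffun I -> R^o}) | v <- enum A]>>%VS)
  = [forall i, (i \notin A) ==> (x i == 0)].
Proof.
set s := [seq _ | v <- _]; apply/idP/forallP => [xs i | x0].
  apply/implyP => iA; rewrite (@coord_span _ _ _ (in_tuple s) x xs) sum_ffunE.
  rewrite big1 // => k _; rewrite ffunE.
  have : s`_k \in s by rewrite mem_nth.
  case/mapP => v; rewrite mem_enum => vA ->; rewrite ffunE.
  by case: eqP => [iv|_]; [rewrite iv vA in iA | rewrite scaler0].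
have -> : x = \sum_(i in A) x i *: [ffun u => (u == i)%:R].
  apply/ffunP => i; rewrite sum_ffunE.
  under eq_bigr do rewrite !ffunE.
  have [iA|iA] := boolP (i \in A).
    rewrite (bigD1 i) //= eqxx [X in X + _]mulr1 big1 ?addr0 // => j.
    by case/andP => _; rewrite eq_sym => /negPf ->; rewrite scaler0.
  have := x0 i; rewrite iA => /eqP ->; rewrite big1 // => j jA.
  by case: eqP => [ij|_]; [rewrite ij jA in iA | rewrite scaler0].
apply: memv_suml => i iA; apply/memvZ/memv_span.
by apply/mapP; exists i; rewrite ?mem_enum.
Qed.

Variables (R : realType) (d : Order.disp_t) (T : finOrderType d).
Implicit Types (V VK VL : {set T}) (f g p : T -> R).

(** * Functions on the vertices as column vectors *)

(** Vertex functions are defined on all of [T], so that the same function can be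
    restricted to [VK] and to [VL]. *)
Definition restr V f : 'cV[R]_#|V| := \col_i f (enum_val i).

Lemma restrE V f g : restr V f = restr V g <-> {in V, f =1 g}.
Proof.
split=> [/colP fg v vV | fg].
  by have := fg (enum_rank_in vV v); rewrite !mxE enum_rankK_in.
by apply/colP => i; rewrite !mxE fg ?enum_valP.
Qed.

Lemma restr_onto V (x : 'cV[R]_#|V|) : exists f, x = restr V f.
Proof.
exists (fun t => \sum_j (enum_val j == t)%:R * x j 0); apply/colP => i.
rewrite mxE (bigD1 i) //= eqxx mul1r big1 ?addr0 // => j ji.
by rewrite (inj_eq enum_val_inj) (negPf ji) mul0r.
Qed.

Lemma dot_restr V f g :
  ((restr V f)^T *m restr V g) 0 0 = \sum_(v in V) f v * g v.
Proof.
rewrite mxE [RHS]big_enum_val; apply: eq_bigr => i _.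
by rewrite !mxE.
Qed.

Definition dipole (v w : T) : T -> R := fun t => (t == w)%:R - (t == v)%:R.

Lemma indicator_dipole V v w :
  indicator R V w - indicator R V v = restr V (dipole v w).
Proof. by apply/colP => i; rewrite !mxE. Qed.

Lemma sum_delta (I : finType) (P : pred I) (a : I) (F : I -> R) :
  P a -> \sum_(i | P i) (i == a)%:R * F i = F a.
Proof.
move=> Pa; rewrite (bigD1 a) //= eqxx mul1r big1 ?addr0 // => i.
by case/andP=> _ /negPf ->; rewrite mul0r.
Qed.

Lemma sum_dipole V v w f : v \in V -> w \in V ->
  \sum_(t in V) dipole v w t * f t = f w - f v.
Proof.
move=> vV wV; rewrite -(sum_delta (P := mem V) f wV).
rewrite -(sum_delta (P := mem V) f vV) -sumrB.
by apply: eq_bigr => t _; rewrite mulrBl.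
Qed.

(** * Chains and the boundary map *)

Lemma mem_C0 V x : (x \in C0 R V) = [forall t, (t \notin V) ==> (x t == 0)].
Proof. exact: mem_span_delta. Qed.

Lemma mem_C1 V (G : wgraph R V) c :
  (c \in C1 G) = [forall e, (e \notin oriented_edges G) ==> (c e == 0)].
Proof. exact: mem_span_delta. Qed.

Lemma boundaryE c t :
  boundary R T c t = \sum_e c e * ((t == e.2)%:R - (t == e.1)%:R).
Proof.
rewrite lfunE /= /boundary_fun sum_ffunE.
by apply: eq_bigr => e _; rewrite !ffunE.
Qed.

(** The coboundary of [f] is [f e.2 - f e.1]; this is its adjunction with the
    boundary, for the unweighted pairings. *)
Lemma sum_boundary c f :
  \sum_t boundary R T c t * f t = \sum_e c e * (f e.2 - f e.1).
Proof.
under eq_bigr do rewrite boundaryE mulr_suml.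
rewrite exchange_big; apply: eq_bigr => e _ /=.
rewrite -(@sum_delta _ predT e.2 f) // -(@sum_delta _ predT e.1 f) //.
rewrite -sumrB mulr_sumr; apply: eq_bigr => t _.
by rewrite -mulrA mulrBl.
Qed.

(** * Laplacian, potentials and currents of one graph *)

Section OneGraph.
Variables (V : {set T}) (G : wgraph R V).

Lemma adjC v w : adj G v w = adj G w v.
Proof. by rewrite /adj finset.setUC. Qed.

Lemma adj_neq v w : adj G v w -> v != w.
Proof.
move=> /(@eset_sub _ _ _ _ G)[_]; apply: contra_eqN => /eqP ->.
by rewrite finset.setUid cards1.
Qed.

Lemma adj_in v w : adj G v w -> (v \in V) && (w \in V).
Proof.
move=> /(@eset_sub _ _ _ _ G)[/fintype.subsetP sV _].
by rewrite !sV // !inE eqxx ?orbT.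
Qed.

Lemma laplacian_sym : (laplacian G)^T = laplacian G.
Proof.
apply/matrixP => i j; rewrite !mxE.
have [->//|ne] := eqVneq (enum_val j) (enum_val i).
by rewrite /= (eq_sym (enum_val i)) (negPf ne) adjC finset.setUC.
Qed.

(** The Laplacian as an operator on vertex functions, which avoids the indexing
    of the matrix by ordinals. *)
Definition graph_lap f t : R :=
  \sum_(u | adj G t u) wt G [set t; u] * (f t - f u).

Lemma laplacian_restr f : laplacian G *m restr V f = restr V (graph_lap f).
Proof.
apply/colP => i; rewrite !mxE; set v := enum_val i.
have vV : v \in V := enum_valP i.
transitivity (\sum_(u in V) (if v == u then
    \sum_(t in V | adj G v t) wt G [set v; t]%SET
    else if adj G v u then - wt G [set v; u]%SET else 0) * f u).
  by rewrite [RHS]big_enum_val; apply: eq_bigr => j _; rewrite !mxE.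
rewrite (bigD1 v) //= eqxx /graph_lap.
under [RHS]eq_bigr do rewrite mulrBr.
rewrite sumrB -mulr_suml; congr (_ * _ + _).
  by apply: eq_bigl => u; apply: andb_idl => /adj_in/andP[].
rewrite -sumrN [RHS]big_mkcond /= [LHS]big_mkcond; apply: eq_bigr => u _.
have [uv|uv] := boolP (adj G v u).
  have /andP[_ ->] := adj_in uv.
  by rewrite eq_sym (adj_neq uv) (negPf (adj_neq uv)) mulNr.
by case: ifP => // /andP[_ ne]; rewrite eq_sym (negPf ne) mul0r.
Qed.

(** The right-hand side meets each edge twice, once from either endpoint. *)
Lemma dirichlet_energy f : (\sum_(v in V) f v * graph_lap f v) *+ 2 =
  \sum_v \sum_(u | adj G v u) wt G [set v; u] * (f v - f u) ^+ 2.
Proof.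
have -> : \sum_(v in V) f v * graph_lap f v =
    \sum_v \sum_(u | adj G v u) wt G [set v; u] * (f v * (f v - f u)).
  rewrite big_mkcond; apply: eq_bigr => v _.
  case: ifPn => vV; rewrite ?mulr_sumr.
    by apply: eq_bigr => u _; rewrite mulrCA.
  by rewrite big1 // => u /adj_in; rewrite (negPf vV).
rewrite mulr2n [X in X + _ = _](exchange_big_dep predT) //= -big_split /=.
apply: eq_bigr => v _.
rewrite [X in X + _ = _](eq_bigl (adj G v)) => [|u]; last exact: adjC.
rewrite -big_split; apply: eq_bigr => u _ /=.
rewrite [(u |: _)%SET]finset.setUC -mulrDr -opprB mulrN -mulNr -mulrDl.
by rewrite expr2 addrC.
Qed.

(** A harmonic function has zero Dirichlet energy, a sum of nonnegative terms
    which controls the increments of the function along the edges. *)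
Lemma harmonic_adj f : {in V, forall v, graph_lap f v = 0} ->
  forall v u, adj G v u -> f v = f u.
Proof.
move=> hf v u vu; have := dirichlet_energy f.
rewrite big1 ?mul0rn => [/esym/eqP|t /hf ->]; last by rewrite mulr0.
have pos a b : adj G a b -> 0 <= wt G [set a; b] * (f a - f b) ^+ 2.
  by move=> ab; rewrite mulr_ge0 ?sqr_ge0 // ltW // wt_gt0.
rewrite psumr_eq0 => [/allP/(_ v (mem_index_enum _))/=|a _]; last first.
  by apply: sumr_ge0 => b; apply: pos.
rewrite psumr_eq0 => [/allP/(_ u (mem_index_enum _))/=|b]; last exact: pos.
by rewrite vu mulf_eq0 gt_eqF ?wt_gt0 //= sqrf_eq0 subr_eq0 => /eqP.
Qed.

Lemma harmonic_connected f : connected_graph G ->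
  {in V, forall v, graph_lap f v = 0} -> {in V &, forall v w, f v = f w}.
Proof.
move=> conn hf v w vV wV; have /connectP[p] := conn v w vV wV.
elim: p v {vV} => [|u p IHp] v /=; first by move=> _ ->.
by case/andP => vu /IHp{}IHp /IHp <-; apply: harmonic_adj.
Qed.

(** The candidate is the pseudo-inverse applied to the dipole. What it misses is
    a residual orthogonal to the range of the Laplacian, thus harmonic by
    symmetry, thus constant; a constant is orthogonal to the dipole, and the
    residual is then orthogonal to itself. *)
Lemma potential_exists v w : connected_graph G -> v \in V -> w \in V ->
  exists f, {in V, graph_lap f =1 dipole v w}.
Proof.
move=> conn vV wV; set b := restr V (dipole v w).
have [AXA _ AX _] := MPinverseP (laplacian G).
have AAX :
    laplacian G *m (laplacian G *m MPinverse (laplacian G)) = laplacian G.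
  by rewrite -{1}laplacian_sym -AX -trmx_mul AXA laplacian_sym.
have [f fE] := restr_onto (MPinverse (laplacian G) *m b).
exists f; apply/restrE; rewrite -laplacian_restr -fE.
have [r rE] := restr_onto (b - laplacian G *m (MPinverse (laplacian G) *m b)).
have Ar : laplacian G *m restr V r = 0.
  by rewrite -rE mulmxBr 2![X in _ - X]mulmxA -(mulmxA _ _ (MPinverse _)) AAX
    subrr.
have rA : (restr V r)^T *m laplacian G = 0.
  by rewrite -laplacian_sym -trmx_mul Ar trmx0.
have /restrE hr : restr V (graph_lap r) = restr V (fun=> 0).
  by rewrite -laplacian_restr Ar; apply/colP => i; rewrite !mxE.
(* The residual is orthogonal to the range, so only the dipole remains. *)
have rr : \sum_(t in V) r t * r t = 0.
  rewrite -dot_restr -{2}rE mulmxBr [X in _ - X]mulmxA.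
  rewrite rA mul0mx subr0 dot_restr.
  under eq_bigr do rewrite mulrC.
  by rewrite sum_dipole // (harmonic_connected conn hr wV vV) subrr.
apply/esym/eqP; rewrite -subr_eq0 rE; apply/eqP/colP => i; rewrite !mxE.
move/eqP: rr; rewrite psumr_eq0 => [/allP rr|t _].
  have := rr (enum_val i) (mem_index_enum _).
  by rewrite enum_valP /= -expr2 sqrf_eq0 => /eqP.
by rewrite -expr2 sqr_ge0.
Qed.

Lemma eff_res_potential v w f : v \in V -> w \in V ->
  {in V, graph_lap f =1 dipole v w} -> eff_res G v w = f w - f v.
Proof.
move=> vV wV /restrE; rewrite -laplacian_restr => fE.
rewrite /eff_res indicator_dipole (quad_MPinverse laplacian_sym fE).
by rewrite dot_restr sum_dipole.
Qed.

(** The indicator [h] of the component of [v] is harmonic, hence orthogonal to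
    the range of the symmetric Laplacian; its pairing with the dipole is [-1] if
    [w] lies in another component. *)
Lemma connected_of_potentials :
  (forall v w, v \in V -> w \in V ->
     exists f, {in V, graph_lap f =1 dipole v w}) ->
  connected_graph G.
Proof.
move=> pot v w vV wV; apply/negPn/negP => nvw.
have [f fE] := pot v w vV wV.
pose h t : R := (connect (adj G) v t)%:R.
have hadj t u : adj G t u -> h t = h u.
  move=> tu; rewrite /h; congr (_ %:R); congr nat_of_bool.
  apply/idP/idP => [vt|vu]; first exact: connect_trans vt (connect1 tu).
  by apply: connect_trans vu (connect1 _); rewrite adjC.
have h0 : laplacian G *m restr V h = 0.
  rewrite laplacian_restr; apply/colP => i.
  by rewrite !mxE /graph_lap big1 // => u /hadj ->; rewrite subrr mulr0.
have : \sum_(t in V) dipole v w t * h t = 0.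
  under eq_bigr do rewrite mulrC.
  rewrite -dot_restr -(proj2 (restrE _ _ _) fE) -laplacian_restr mulmxA.
  by rewrite -laplacian_sym -trmx_mul h0 trmx0 mul0mx mxE.
rewrite sum_dipole // /h (negPf nvw) connect0 sub0r => /eqP.
by rewrite oppr_eq0 oner_eq0.
Qed.

(** Ohm's law: the weights are conductances. *)
Definition current f : {ffun T * T -> R^o} :=
  [ffun e => if e \in oriented_edges G
             then wt G [set e.1; e.2]%SET * (f e.2 - f e.1) else 0].

(** Both sides are the net flow at [t]. The edge to a neighbour [u] is oriented
    by the order of [t] and [u], but the sign of the current and the sign of the
    boundary compensate each other. *)
Lemma boundary_current f t : boundary R T (current f) t = graph_lap f t.
Proof.
rewrite boundaryE.
transitivity (\sum_a \sum_b current f (a, b) *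
    ((t == b)%:R - (t == a)%:R)).
  by rewrite pair_bigA; apply: eq_bigr => -[a b] _.
have delta F : \sum_b F b * (t == b)%:R = F t :> R.
  rewrite -(@sum_delta _ predT t F) //.
  by apply: eq_bigr => b _; rewrite mulrC eq_sym.
under eq_bigr => a _.
  under eq_bigr do rewrite mulrBr.
  rewrite sumrB delta -mulr_suml; over.
rewrite sumrB delta -sumrB [RHS]big_mkcond; apply: eq_bigr => u _.
rewrite !ffunE !finset.inE /=.
rewrite -[[set u; t]%SET \in _]/(adj G u t) -[[set t; u]%SET \in _]/(adj G t u).
rewrite [[set u; t]%SET]finset.setUC (adjC u t).
case: (boolP (adj G t u)) => [tu | _]; last by rewrite !andbF subrr.
rewrite !andbT; have := adj_neq tu.
by case: ltgtP => //= _ _; rewrite ?subr0 // sub0r -mulrN opprB.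
Qed.

Lemma graph_lap_out f t : t \notin V -> graph_lap f t = 0.
Proof.
by move=> tV; rewrite /graph_lap big1 // => u /adj_in; rewrite (negPf tV).
Qed.

Lemma current_C1 f : current f \in C1 G.
Proof.
rewrite mem_C1; apply/forallP => e; apply/implyP => eG.
by rewrite ffunE (negPf eG).
Qed.

(** The weight of an edge in the current cancels the inverse weight in the inner
    product, which leaves the plain coboundary of [f]. *)
Lemma ip1_current c f : c \in C1 G ->
  ip1 G c (current f) = \sum_e c e * (f e.2 - f e.1).
Proof.
rewrite mem_C1 => /forallP c0; rewrite /ip1 big_mkcond; apply: eq_bigr => e _.
have := c0 e; rewrite ffunE; case: ifPn => [|_ /eqP ->]; last by rewrite mul0r.
rewrite finset.inE => eG _; rewrite eG.
case/andP: eG => _ /(wt_gt0 (w := G)) w0.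
by rewrite mulrCA mulKf ?gt_eqF.
Qed.

(** The inner product is definite on [C1 G], and [c - c'] is the only vector
    against which the difference needs to be tested. *)
Lemma ip1_inj c c' : c \in C1 G -> c' \in C1 G ->
  ip1 G (c - c') c = ip1 G (c - c') c' -> c = c'.
Proof.
rewrite !mem_C1 => /forallP c0 /forallP c0' /eqP.
have w0 e : e \in oriented_edges G -> 0 < (wt G [set e.1; e.2]%SET)^-1.
  by rewrite finset.inE => /andP[_ eG]; rewrite invr_gt0 wt_gt0.
have cE e : (wt G [set e.1; e.2]%SET)^-1 * ((c - c') e * c e) -
    (wt G [set e.1; e.2]%SET)^-1 * ((c - c') e * c' e) =
    (wt G [set e.1; e.2]%SET)^-1 * (c e - c' e) ^+ 2.
  by rewrite -mulrBr -mulrBr !ffunE expr2.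
rewrite -subr_eq0 -sumrB (eq_bigr _ (fun e _ => cE e)) psumr_eq0 => [|e eG].
  move/allP => cc; apply/ffunP => e.
  have := cc e (mem_index_enum _); have := c0 e; have := c0' e.
  case: (boolP (e \in _)) => [eG _ _ /=|_ /eqP -> /eqP ->] //.
  by rewrite mulf_eq0 gt_eqF ?w0 //= sqrf_eq0 subr_eq0 => /eqP.
by rewrite mulr_ge0 ?sqr_ge0 // ltW ?w0.
Qed.

End OneGraph.

(** * The persistent Laplacian *)

Section Pair.
Variables (VK VL : {set T}) (K : wgraph R VK) (L : wgraph R VL).

(** Currents with boundary in [C0 VK] are the values of the adjoint: against any
    chain [c] with boundary in [C0 VK], both sides give the pairing of [f] with
    the boundary of [c], which involves the values of [f] on [VK] only. *)
Lemma adjoint_current f (y : subvs_of (C0 R VK)) :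
  {in VK, vsval y =1 f} -> current L f \in C1_pers VK L ->
  adjoint (@ip_C1_pers _ _ _ VK VL L) (@ip_C0 _ _ _ VK) (boundary_pers VK L) y
  = vsproj (C1_pers VK L) (current L f).
Proof.
move=> yf fC; set z := adjoint _ _ _ y.
apply/val_inj; rewrite /= vsprojK //.
have pers (c : subvs_of (C1_pers VK L)) :
    vsval c \in C1 L /\ boundary R T (vsval c) \in C0 R VK.
  by have := subvsP c; rewrite memv_cap -memv_preim => /andP.
have fC1 := current_C1 L f.
have zC1 := (pers z).1.
(* The two sides agree against every test chain; definiteness concludes. *)
have key (c : subvs_of (C1_pers VK L)) :
    ip1 L (vsval c) (vsval z) = ip1 L (vsval c) (current L f).
  have [cC1 bC] := pers c.
  rewrite ip1_current // -sum_boundary.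
  have := boundary_pers_adjointP c y; rewrite /ip_C1_pers => <-.
  rewrite /ip_C0 /boundary_pers !comp_lfunE !lfunE /= vsprojK; last first.
    by rewrite lfunE in bC.
  apply: eq_bigr => t _; have [tK|tK] := boolP (t \in VK); first by rewrite yf.
  move: bC; rewrite mem_C0 lfunE => /forallP/(_ t); rewrite tK => /eqP ->.
  by rewrite !mul0r.
apply: (ip1_inj (G := L)) => //.
have := key (z - vsproj (C1_pers VK L) (current L f)).
by rewrite linearB /= vsprojK.
Qed.

(** Since the persistent Laplacian is the boundary after its adjoint, it sends
    the restriction of [f] to the boundary of the current of [f]. *)
Lemma pers_laplacian_potential f p :
  {in VL, graph_lap L f =1 p} -> (forall t, t \notin VK -> p t = 0) ->
  VK \subset VL ->
  pers_laplacian K L *m restr VK f = restr VK p.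
Proof.
move=> fp p0 sKL.
pose x : {ffun T -> R^o} := [ffun t => if t \in VK then f t else 0].
have xC : x \in C0 R VK.
  rewrite mem_C0; apply/forallP => t.
  by rewrite ffunE; case: ifP => //=; rewrite eqxx.
have bp t : boundary R T (current L f) t = p t.
  rewrite boundary_current; have [/fp //|tL] := boolP (t \in VL).
  by rewrite graph_lap_out // p0 //; apply: contra tL => /(fintype.subsetP sKL).
have bC : boundary R T (current L f) \in C0 R VK.
  by rewrite mem_C0; apply/forallP => t; apply/implyP => /p0; rewrite bp => ->.
have fC : current L f \in C1_pers VK L.
  by rewrite memv_cap -memv_preim current_C1.
have PE : vsval (pers_laplacian_map VK L (vsproj (C0 R VK) x)) =
    boundary R T (current L f).
  rewrite /pers_laplacian_map comp_lfunE (adjoint_current (f := f)) //.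
    rewrite /boundary_pers !comp_lfunE [linfun _ _]lfunE.
    by rewrite (lfunE (@vsval _ _ (C1_pers VK L))) /= !vsprojK.
  by move=> t tK; rewrite vsprojK // ffunE tK.
have xE : x = \sum_(j < #|VK|) f (enum_val j) *: vchain R (enum_val j).
  apply/ffunP => t; rewrite ffunE sum_ffunE.
  rewrite -(big_enum_val (fun u => (f u *: vchain R u) t)) /=.
  under eq_bigr do rewrite !ffunE.
  case: ifPn => tK; last first.
    rewrite big1 // => u uK; case: eqP => [tu|_]; last by rewrite scaler0.
    by rewrite tu uK in tK.
  rewrite -(@sum_delta _ (mem VK) t f) //.
  by apply: eq_bigr => u _; rewrite eq_sym mulrC.
apply/colP => i; rewrite !mxE -bp -PE xE !linear_sum sum_ffunE.
by apply: eq_bigr => j _; rewrite !linearZ /= !mxE ffunE mulrC.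
Qed.

End Pair.
End EffectiveResistance.

Theorem theorem4p10 (R : realType) (d : Order.disp_t) (T : finOrderType d)
    (VK VL : {set T}) (K : wgraph R VK) (L : wgraph R VL)
    (Ktilde : wgraph R VK) :
  graph_pair K L -> connected_graph L ->
  laplacian Ktilde = pers_laplacian K L ->
  connected_graph Ktilde /\
  (forall v w : T, v \in VK -> w \in VK -> v <> w ->
     eff_res L v w = eff_res Ktilde v w).
Proof.
move=> [_ sKL _ _] Lconn KtE.
have pot v w : v \in VK -> w \in VK -> exists f,
    {in VL, graph_lap L f =1 dipole R v w} /\
    {in VK, graph_lap Ktilde f =1 dipole R v w}.
  move=> vK wK.
  have [f fL] := potential_exists Lconn
    (fintype.subsetP sKL v vK) (fintype.subsetP sKL w wK).
  exists f; split=> //; apply/restrE; rewrite -laplacian_restr KtE.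
  apply: pers_laplacian_potential => // t tK; rewrite /dipole.
  have tne u : u \in VK -> (t == u) = false.
    by move=> uK; apply/eqP => tu; rewrite tu uK in tK.
  by rewrite !tne // GRing.subrr.
split=> [|v w vK wK _].
  apply: connected_of_potentials => v w vK wK.
  by have [f [_ fK]] := pot v w vK wK; exists f.
have [f [fL fK]] := pot v w vK wK.
rewrite (eff_res_potential vK wK fK) (eff_res_potential _ _ fL) //.
  exact: (fintype.subsetP sKL).
exact: (fintype.subsetP sKL).
Qed.
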